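(* Let $G$ be a group and let $Y\in\Omega(G)$. Then there are finitely many subgroups $H_1,H_2,\dots,H_n$ of $G$ ($n\ge 0$) such that $H_i\in\mathcal R_2(\{Y\})$ for each $i$, and $Y\in\mathcal R(\{H_1,\dots,H_n\})$.
   Context: A coset in $G$ is a set $sK$ with $s\in G$ and $K\le G$ a subgroup (a right coset $Ks=s(s^{-1}Ks)$ is a left coset of a conjugate subgroup). A ring of subsets of a set $X$ is a non-empty collection of subsets of $X$ closed under finite unions, finite intersections and complements in $X$. The coset ring $\Omega(G)$ is the smallest ring of subsets of $G$ containing all cosets of all subgroups of $G$. A relative ring of subsets of $X$ is a collection of subsets of $X$ which contains $\emptyset$ and is closed under finite unions, finite intersections and relative complements ($A,B\in\mathcal S\Rightarrow A\setminus B\in\mathcal S$); it need not contain $X$. For a collection $\mathfrak A$ of subsets of a group $G$, $\mathcal R(\mathfrak A)$ denotes the relative ring of subsets generated by all left translates $sA$ ($A\in\mathfrak A$, $s\in G$), and $\mathcal R_2(\mathfrak A)$ denotes the relative ring of subsets generated by all two-sided translates $sAt$ ($A\in\mathfrak A$, $s,t\in G$). In particular $\mathcal R(\emptyset)=\{\emptyset\}$. *)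

(* Defs.v *)
From HB Require Import structures.
From mathcomp Require Import all_boot.
From mathcomp Require Import boolp classical_sets measurable_structure.

Set Implicit Arguments.
Unset Strict Implicit.
Unset Printing Implicit Defensive.

Local Open Scope group_scope.
Local Open Scope classical_set_scope.

(* A [groupType] is an arbitrary, possibly infinite, group. *)

Definition is_subgroup (G : groupType) (K : set G) : Prop := group_closed [in K].

Definition cosets (G : groupType) : set (set G) :=
  [set [set s * x | x in K] | s in [set: G] & K in @is_subgroup G].
Arguments cosets : clear implicits.

(* Closure under binary unions and intersections is closure under non-empty
   finite ones; the empty union and intersection, A `&` ~` A and A `|` ~` A,
   are obtained from any member A. *)
Definition ring_of_subsets (X : Type) (S : set (set X)) : Prop :=
  [/\ S !=set0, setU_closed S, setI_closed S & setC_closed S].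

Definition coset_ring (G : groupType) : set (set G) :=
  smallest (@ring_of_subsets G) (cosets G).
Arguments coset_ring : clear implicits.

Definition left_translates (G : groupType) (F : set (set G)) : set (set G) :=
  [set [set s * x | x in A] | s in [set: G] & A in F].

Definition two_sided_translates (G : groupType) (F : set (set G)) :
    set (set G) :=
  [set B | exists s t, exists2 A, F A & B = [set s * x * t | x in A]].

(* A relative ring of subsets is a [setring]; closure under intersections, which
   [setring] does not list, is automatic. *)
Lemma setring_setI_closed (X : Type) (S : set (set X)) :
  setring S -> setI_closed S.
Proof.
by move=> [_ _ SD] A B SA SB; rewrite -setDD; apply: (SD) => //; apply: SD.
Qed.

Definition left_ring (G : groupType) (F : set (set G)) : set (set G) :=
  <<r left_translates F >>.

Definition two_sided_ring (G : groupType) (F : set (set G)) : set (set G) :=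
  <<r two_sided_translates F >>.

(* Main.v *)
(* Write "almost contained" for containment up to finite index, and call a set
   small relative to a subgroup L if it is covered by finitely many cosets of
   subgroups that do not almost contain L.

   The key point is that B = R_2({Y}) contains a subgroup commensurable with L
   as soon as it contains a non-small set covered by finitely many left cosets
   of L and a small set. Intersecting a set A covered by cosets c M with
   finitely many right (resp. left) translates of itself by elements of a
   subgroup N removes every c M such that N is not almost contained in M (resp.
   in c M c^-1), by Neumann's lemma and the descending chain condition on finite
   unions of cosets. Hence a set A as above that is covered by as few left cosets
   a L as possible only involves cosets for which the groups a L a^-1 are
   commensurable. Translations by a subgroup of finite index then turn A into an
   exact union V of cosets of a subgroup of finite index in L, and a minimal
   non-empty union of such cosets in B is a left coset of a subgroup that
   belongs to B.

   Now let A in B be a Boolean combination of cosets of subgroups that are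
   commensurable with members of a finite family F closed under intersections,
   and let L be maximal in F for almost containment. Then A agrees with a finite
   union V of cosets of a subgroup commensurable with L, up to an element of the
   ring of the members of F that do not almost contain L. Localizing on cosets
   of the subgroup found above shows that V is in B, hence in the left ring of
   the subgroups of B, and induction on F applies to the symmetric difference of
   A and V. *)
Require Import Defs.
From HB Require Import structures.
From mathcomp Require Import all_boot.
From mathcomp Require Import boolp classical_sets measurable_structure.

Local Open Scope classical_set_scope.

Section CosetRing.
Local Open Scope group_scope.
Context {G : groupType}.
Implicit Types (x y g : G) (A V L M N K : set G) (cs : seq (G * set G)).
Implicit Types (P : set (set G)).

Ltac gsimp := rewrite ?(invgM, invgK, mulgA, mulgK, mulgVK, mulVg, mulgV,
  mul1g, mulg1, invg1).

(** * Subgroups and cosets *)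

Lemma subgroup1 {K} : is_subgroup K -> K 1.
Proof. by case=> /set_mem. Qed.

Lemma subgroupF {K} : is_subgroup K -> forall x y, K x -> K y -> K (x * y^-1).
Proof. by case=> _ KF x y Kx Ky; apply/set_mem/KF; apply/mem_set. Qed.

Lemma subgroupV {K} : is_subgroup K -> forall x, K x -> K x^-1.
Proof. by move=> sK x Kx; rewrite -[x^-1]mul1g; apply: subgroupF => //; apply: subgroup1. Qed.

Lemma subgroupM {K} : is_subgroup K -> forall x y, K x -> K y -> K (x * y).
Proof. by move=> sK x y Kx Ky; rewrite -[y]invgK; apply: subgroupF => //; apply: subgroupV. Qed.

Lemma is_subgroupP K :
  K 1 -> (forall x y, K x -> K y -> K (x * y^-1)) -> is_subgroup K.
Proof.
move=> K1 KF; split; first exact/mem_set.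
by move=> x y /set_mem Kx /set_mem Ky; apply/mem_set/KF.
Qed.

Lemma subgroupMl {K} : is_subgroup K -> forall x y, K x -> K (x * y) <-> K y.
Proof.
move=> sK x y Kx; split=> [Kxy|]; last exact: subgroupM.
by rewrite -(mulKg x y); apply: subgroupM => //; apply: subgroupV.
Qed.

Lemma subgroupMr {K} : is_subgroup K -> forall x y, K y -> K (x * y) <-> K x.
Proof.
move=> sK x y Ky; split=> [Kxy|Kx]; last exact: subgroupM.
by rewrite -(mulgK y x); apply: subgroupF.
Qed.

Lemma subgroupT : is_subgroup [set: G].
Proof. exact: is_subgroupP. Qed.

Lemma subgroupI M N : is_subgroup M -> is_subgroup N -> is_subgroup (M `&` N).
Proof.
move=> sM sN; apply: is_subgroupP => [|x y [Mx Nx] [My Ny]].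
  by split; apply: subgroup1.
by split; apply: subgroupF.
Qed.

(** Preimages rather than images, so that membership computes: [conj x M] is $xMx^{-1}$, while
    [ltrans g A] and [rtrans g A] are $g^{-1}A$ and $Ag^{-1}$. *)
Definition lcoset x M : set G := [set y | M (x^-1 * y)].
Definition conj x M : set G := [set y | M (x^-1 * y * x)].
Definition ltrans g A : set G := [set y | A (g * y)].
Definition rtrans g A : set G := [set y | A (y * g)].

Lemma conjM x y M : conj (x * y) M = conj x (conj y M).
Proof. by rewrite /conj; apply/seteqP; split=> z /=; gsimp. Qed.

Lemma conj1 M : conj 1 M = M.
Proof. by rewrite /conj; apply/seteqP; split=> z /=; gsimp. Qed.

Lemma conjVK x M : conj x^-1 (conj x M) = M.
Proof. by rewrite -conjM mulVg conj1. Qed.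

Lemma subgroup_conj x M : is_subgroup M -> is_subgroup (conj x M).
Proof.
move=> sM; apply: is_subgroupP; first by rewrite /conj /=; gsimp; apply: subgroup1.
move=> y z /= My Mz.
have := subgroupF sM _ _ My Mz; rewrite /conj /=; by gsimp.
Qed.

Lemma conj_id x M : is_subgroup M -> M x -> conj x M = M.
Proof.
move=> sM Mx; apply/seteqP; split=> y; rewrite /conj /=.
  by move/(subgroupMr sM _ _ Mx)/(subgroupMl sM _ _ (subgroupV sM _ Mx)).
by move=> My; apply: subgroupM => //; apply: subgroupM => //; apply: subgroupV.
Qed.

Lemma lcoset_refl x M : is_subgroup M -> lcoset x M x.
Proof. by move=> sM; rewrite /lcoset /= mulVg; apply: subgroup1. Qed.

Lemma lcoset_eq x y M : is_subgroup M -> lcoset x M y -> lcoset x M = lcoset y M.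
Proof.
move=> sM xy; apply/seteqP; rewrite /lcoset; split=> z /= H.
  have -> : y^-1 * z = (x^-1 * y)^-1 * (x^-1 * z) by gsimp.
  by apply: subgroupM => //; apply: subgroupV.
have -> : x^-1 * z = (x^-1 * y) * (y^-1 * z) by gsimp.
exact: subgroupM.
Qed.

Lemma conj_lcoset x y M : is_subgroup M -> lcoset x M y -> conj x M = conj y M.
Proof.
by move=> sM xy; rewrite -[y](mulVKg x) conjM (conj_id (x^-1 * y)).
Qed.

(** * Coverings by finitely many cosets *)

Definition union_lcosets cs : set G :=
  [set y | exists2 c, c \in cs & lcoset c.1 c.2 y].

Definition covered P A : Prop :=
  exists2 cs, {in cs, forall c, P c.2} & A `<=` union_lcosets cs.

Lemma covered_sub P A B : A `<=` B -> covered P B -> covered P A.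
Proof. by move=> AB [cs Pcs Bcs]; exists cs => //; apply: subset_trans Bcs. Qed.

Lemma covered_impl P Q A : P `<=` Q -> covered P A -> covered Q A.
Proof. by move=> PQ [cs Pcs Acs]; exists cs => // c /Pcs /PQ. Qed.

Lemma covered0 P : covered P set0.
Proof. by exists [::]. Qed.

Lemma coveredU P A B : covered P A -> covered P B -> covered P (A `|` B).
Proof.
move=> [cs Pcs Acs] [ds Pds Bds]; exists (cs ++ ds).
  by move=> c; rewrite mem_cat => /orP[/Pcs|/Pds].
move=> y [/Acs[c cin cy]|/Bds[c cin cy]]; exists c => //;
  by rewrite mem_cat cin ?orbT.
Qed.

Lemma covered_seq {I : eqType} (s : seq I) P (A : I -> set G) :
  {in s, forall i, covered P (A i)} ->
  covered P [set y | exists2 i, i \in s & A i y].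
Proof.
elim: s => [_|i s IH H]; first by apply: covered_sub (covered0 P) => y [].
apply: covered_sub (coveredU P _ _ (H i _) (IH _)).
- by move=> y [j]; rewrite inE => /orP[/eqP->|js Ay]; [left|right; exists j].
- by rewrite inE eqxx.
- by move=> j js; apply: H; rewrite inE js orbT.
Qed.

Lemma covered_lcoset P x M : P M -> covered P (lcoset x M).
Proof.
move=> PM; exists [:: (x, M)]; first by move=> c; rewrite inE => /eqP->.
by move=> y xy; exists (x, M); rewrite ?inE.
Qed.

Lemma covered_self P M : P M -> covered P M.
Proof.
move=> PM; apply: covered_sub (covered_lcoset P 1 M PM).
by move=> x; rewrite /lcoset /= invg1 mul1g.
Qed.

Lemma covered_ltrans P g A : covered P A -> covered P (ltrans g A).
Proof.
move=> [cs Pcs Acs]; exists [seq (g^-1 * c.1, c.2) | c <- cs].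
  by move=> _ /mapP[c /Pcs Pc ->].
move=> y /Acs[c cin cy]; exists (g^-1 * c.1, c.2); first exact: map_f.
by move: cy; rewrite /lcoset /=; gsimp.
Qed.

Lemma covered_trans P Q A :
  covered P A -> (forall M, P M -> covered Q M) -> covered Q A.
Proof.
move=> [cs Pcs Acs] PQ.
apply: covered_sub (covered_seq cs Q (fun c => lcoset c.1 c.2) _) => //.
by move=> c /Pcs /PQ /(covered_ltrans _ c.1^-1).
Qed.

(** Only the cosets of [L] that meet [A] and [B] jointly matter, and each of them can be based at a
    point of both sets, where hypotheses on such points apply. *)
Lemma covered_local L A B P : covered [set L] A -> is_subgroup L ->
  (forall y, A y -> B y -> covered P (lcoset y L `&` B)) -> covered P (A `&` B).
Proof.
move=> [cs Lcs Acs] sL H.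
apply: covered_sub (covered_seq cs P (fun c => lcoset c.1 L `&` (A `&` B)) _).
  move=> y [Ay By]; have [c cin cy] := Acs y Ay; exists c => //.
  by split=> //; rewrite -(Lcs c cin).
move=> c _; have [[y [cy [Ay By]]]|H0] := pselect (exists y, (lcoset c.1 L `&` (A `&` B)) y).
  apply: covered_sub (H y Ay By); rewrite (lcoset_eq _ _ _ sL cy).
  by move=> z [? []].
by apply: covered_sub (covered0 P) => y Hy; apply: H0; exists y.
Qed.

(** Two cosets $xM$ and $yN$ are either disjoint or meet in a coset of $M\cap N$. *)
Lemma covered_meet P Q A B :
  P `<=` @is_subgroup G -> Q `<=` @is_subgroup G -> covered P A -> covered Q B ->
  covered [set S | exists2 M, P M & exists2 N, Q N & S = M `&` N] (A `&` B).
Proof.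
move=> sP sQ [cs Pcs Acs] [ds Qds Bds].
set R := (X in covered X).
apply: covered_sub (covered_seq cs R (fun c => lcoset c.1 c.2 `&` B) _).
  by move=> y [/Acs[c cin cy] By]; exists c.
move=> c cin; apply: covered_sub (covered_seq ds R (fun d => lcoset c.1 c.2 `&` lcoset d.1 d.2) _).
  by move=> y [cy /Bds[d din dy]]; exists d.
move=> d din.
have [[y [cy dy]]|H0] := pselect (exists y, (lcoset c.1 c.2 `&` lcoset d.1 d.2) y); last first.
  by apply: covered_sub (covered0 R) => y Hy; apply: H0; exists y.
rewrite (lcoset_eq _ _ _ (sP _ (Pcs _ cin)) cy) (lcoset_eq _ _ _ (sQ _ (Qds _ din)) dy).
apply: (covered_lcoset R y (c.2 `&` d.2)).
by exists c.2; [exact: Pcs|exists d.2 => //; exact: Qds].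
Qed.

(** * Almost containment (for subgroups, $M\cap N$ has finite index in $N$) and Neumann's lemma *)

Definition almost_sub N M : Prop := covered [set M] N.

Lemma almost_sub_trans L M N : almost_sub L M -> almost_sub M N -> almost_sub L N.
Proof. by move=> LM MN; apply: covered_trans LM _ => _ ->. Qed.

Lemma sub_almost_sub M N : M `<=` N -> almost_sub M N.
Proof. by move=> MN; apply: covered_sub MN (covered_self _ _ _). Qed.

Lemma almost_subI L M N : is_subgroup M -> is_subgroup N ->
  almost_sub L M -> almost_sub L N -> almost_sub L (M `&` N).
Proof.
move=> sM sN LM LN; rewrite /almost_sub -[L]setIid.
apply: covered_impl (covered_meet _ _ _ _ _ _ LM LN); last 2 first.
- by move=> _ ->.
- by move=> _ ->.
- by move=> _ [_ -> [_ -> ->]].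
Qed.

Lemma covered_conj g P A :
  covered P A -> covered [set conj g M | M in P] (conj g A).
Proof.
move=> [cs Pcs Acs]; exists [seq (g * c.1 * g^-1, conj g c.2) | c <- cs].
  by move=> _ /mapP[c /Pcs Pc ->]; exists c.2.
move=> y /Acs[c cin cy]; exists (g * c.1 * g^-1, conj g c.2).
  by apply/mapP; exists c.
by move: cy; rewrite /lcoset /conj /=; gsimp.
Qed.

Lemma almost_sub_conj g M N : almost_sub M N -> almost_sub (conj g M) (conj g N).
Proof.
by move=> /(covered_conj g); apply: covered_impl => _ [_ -> <-].
Qed.

Lemma almost_sub_conjl g M N : almost_sub (conj g M) N <-> almost_sub M (conj g^-1 N).
Proof.
split=> [/(almost_sub_conj g^-1)|/(almost_sub_conj g)]; first by rewrite conjVK.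
by rewrite -conjM mulgV conj1.
Qed.

(** A right translate of a left coset is a left coset of a conjugate:
    $cMg^{-1}=(cg^{-1})(gMg^{-1})$. *)
Lemma covered_rtrans g P A :
  covered P A -> covered [set conj g M | M in P] (rtrans g A).
Proof.
move=> [cs Pcs Acs]; exists [seq (c.1 * g^-1, conj g c.2) | c <- cs].
  by move=> _ /mapP[c /Pcs Pc ->]; exists c.2.
move=> y /Acs[c cin cy]; exists (c.1 * g^-1, conj g c.2).
  by apply/mapP; exists c.
by move: cy; rewrite /lcoset /conj /=; gsimp.
Qed.

Lemma almost_sub_seqI {I : eqType} (s : seq I) (M : I -> set G) N :
  is_subgroup N -> {in s, forall i, is_subgroup (M i) /\ almost_sub N (M i)} ->
  exists K, [/\ is_subgroup K, almost_sub N K, K `<=` N & {in s, forall i, K `<=` M i}].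
Proof.
move=> sN; elim: s => [_|i s IH H].
  by exists N; split=> //; exact: sub_almost_sub.
have [|K [sK NK KN KM]] := IH; first by move=> j js; apply: H; rewrite inE js orbT.
have [|sM NM] := H i; first by rewrite inE eqxx.
exists (K `&` M i); split.
- exact: subgroupI.
- exact: almost_subI.
- by move=> x [/KN].
- by move=> j; rewrite inE => /orP[/eqP->|/KM KMj] x [] // /KMj.
Qed.

(* B.H. Neumann's lemma. *)
Lemma neumann (Ms : seq (set G)) N : is_subgroup N ->
  {in Ms, forall M, is_subgroup M} -> covered [set M | M \in Ms] N ->
  exists2 M, M \in Ms & almost_sub N M.
Proof.
move=> sN; elim: Ms => [|M Ms IH] sMs [cs csM Ncs].
  by have [c /csM] := Ncs 1 (subgroup1 sN).
have sM : is_subgroup M by apply: sMs; rewrite inE eqxx.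
have [NM|] := pselect (N `<=` union_lcosets [seq c <- cs | c.2 == M]).
  exists M; rewrite ?inE ?eqxx//; exists [seq c <- cs | c.2 == M] => // c.
  by rewrite mem_filter => /andP[/eqP].
move=> /existsNP[n0 /not_implyP[Nn0 n0M]].
(* The cosets of [M] in [cs] miss $n_0$, hence all of $n_0M$, so the other subgroups cover $n_0M\cap
   N$. Left translation by $n_0z^{-1}$ carries $zM\cap N$ into it, so they cover every coset of [M]
   within [N]. *)
have covn0 : covered [set M | M \in Ms] (lcoset n0 M `&` N).
  exists [seq c <- cs | c.2 != M] => [c|y [ny /Ncs[c cin cy]]].
    by rewrite mem_filter => /andP[cM /csM /=]; rewrite inE (negbTE cM).
  exists c => //; rewrite mem_filter cin andbT.
  apply/eqP => cM; apply: n0M; exists c; first by rewrite mem_filter cM eqxx.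
  rewrite cM in cy *; rewrite (lcoset_eq _ _ _ sM cy) -(lcoset_eq _ _ _ sM ny).
  exact: lcoset_refl.
have [||M' M'in NM'] := IH; last by exists M'; rewrite // inE M'in orbT.
  by move=> M' M'in; apply: sMs; rewrite inE M'in orbT.
apply: covered_sub (covered_seq cs _ (fun c => lcoset c.1 c.2 `&` N) _).
  by move=> y Ny; have [c cin cy] := Ncs y Ny; exists c.
move=> c cin; move: (csM c cin) => /=; rewrite inE => /orP[/eqP cM|cMs]; last first.
  exact: covered_sub (@subIsetl _ _ _) (covered_lcoset _ _ _ cMs).
have [[z [cz Nz]]|H0] := pselect (exists z, (lcoset c.1 c.2 `&` N) z); last first.
  by apply: covered_sub (covered0 _) => y Hy; apply: H0; exists y.
rewrite cM in cz *; apply: covered_sub (covered_ltrans _ (n0 * z^-1) _ covn0).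
move=> y [cy Ny]; split.
  by move: cy; rewrite (lcoset_eq _ _ _ sM cz) /lcoset /=; gsimp.
by rewrite /=; apply: subgroupM => //; apply: subgroupF.
Qed.

(** Otherwise intersect [N] with the subgroups that almost contain it and whose coset in [cs] misses
    1. The resulting [D] has finite index in [N] and avoids those cosets, so it is covered by cosets
    of subgroups that do not almost contain [N], against Neumann's lemma. *)
Lemma neumann_at1 N cs : is_subgroup N ->
  {in cs, forall c, is_subgroup c.2} -> N `<=` union_lcosets cs ->
  exists c, [/\ c \in cs, lcoset c.1 c.2 1 & almost_sub N c.2].
Proof.
move=> sN scs Ncs; apply: contrapT => H.
have H' c : c \in cs -> lcoset c.1 c.2 1 -> ~ almost_sub N c.2.
  by move=> cin c1 Nc; apply: H; exists c.
pose ds := [seq c <- cs | `[< ~ lcoset c.1 c.2 1 >]].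
have [|D [sD ND DN DM]] := almost_sub_seqI [seq c <- ds | `[< almost_sub N c.2 >]] snd N sN.
  move=> c; rewrite !mem_filter => /and3P[/asboolP ? _ cin]; split=> //.
  exact: scs.
have [||M] := neumann [seq c.2 | c <- cs & `[< ~ almost_sub N c.2 >]] D sD.
- by move=> _ /mapP[c + ->]; rewrite mem_filter => /andP[_ /scs].
- exists [seq c <- cs | `[< ~ almost_sub N c.2 >]]; first by move=> c cin /=; apply: map_f.
  move=> y Dy; have [c cin cy] := Ncs y (DN _ Dy); exists c => //.
  rewrite mem_filter cin andbT; apply/asboolP => Nc.
  have c1 : ~ lcoset c.1 c.2 1 by move=> /(H' c cin).
  apply: c1; move: cy; rewrite /lcoset /= mulg1.
  move/(subgroupMr (scs _ cin)); apply; apply: DM => //.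
  rewrite !mem_filter cin; apply/and3P; split=> //; apply/asboolP => //.
  by move=> /(H' c cin).
- move=> /mapP[c + ->]; rewrite mem_filter => /andP[/asboolP nNc _] /(almost_sub_trans _ _ _ ND).
  exact: nNc.
Qed.

(** * Erasing cosets by translation *)

(** Since [Q i] is monotone in the list, the finite witnesses for the various [i] can be
    concatenated. *)
Lemma seq_gather {I J : eqType} (s : seq I) (P : J -> Prop) (Q : I -> seq J -> Prop) :
  (forall i r r', {subset r <= r'} -> Q i r -> Q i r') ->
  {in s, forall i, exists2 r, {in r, forall j, P j} & Q i r} ->
  exists2 r, {in r, forall j, P j} & {in s, forall i, Q i r}.
Proof.
move=> Qmono; elim: s => [_|i s IH H]; first by exists [::].
have [|r Pr Qr] := IH; first by move=> j js; apply: H; rewrite inE js orbT.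
have [|r' Pr' Qr'] := H i; first by rewrite inE eqxx.
exists (r' ++ r) => [j|j].
  by rewrite mem_cat => /orP[/Pr'|/Pr].
by rewrite inE => /orP[/eqP->|/Qr Qjr]; [apply: Qmono Qr'|apply: Qmono Qjr];
  move=> k kin; rewrite mem_cat kin ?orbT.
Qed.

Lemma count_ltn {T : eqType} (a b : pred T) (s : seq T) i : i \in s ->
  {in s, forall j, a j -> b j} -> b i -> ~~ a i -> count a s < count b s.
Proof.
move=> si ab bi nai; rewrite -(size_filter b) -(count_predC a) !count_filter.
rewrite (@eq_in_count _ (predI a b) a) => [|j /ab /=]; last by case: (a j) => // ->.
rewrite -[ltnLHS]addn0 ltn_add2l -has_count; apply/hasP; exists i => //=.
by rewrite nai bi.
Qed.

(* Finite unions of left cosets of finitely many subgroups form the closed sets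
   of a Noetherian topology, so the intersection over N is a finite one. *)
Lemma noetherian_ltrans N cs : {in cs, forall c, is_subgroup c.2} ->
  exists2 ls : seq G, {in ls, forall l, N l} &
    forall y, (forall l, l \in ls -> union_lcosets cs (l * y)) ->
      forall n, N n -> union_lcosets cs (n * y).
Proof.
move=> scs.
(* Descending induction inside a coset $xM$, measured by the number of members of [cs] whose
   subgroup does not contain [M]. *)
suff dcc k x M : is_subgroup M -> count (fun c => `[< ~ M `<=` c.2 >]) cs < k ->
    exists2 ls : seq G, {in ls, forall l, N l} &
      forall y, lcoset x M y -> (forall l, l \in ls -> union_lcosets cs (l * y)) ->
        forall n, N n -> union_lcosets cs (n * y).
  have [ls Nls lsP] := dcc _ 1 _ subgroupT (ltnSn _).
  by exists ls => // y; apply: lsP.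
elim: k x M => // k IH x M sM ltk.
have [all|] := pselect (forall y, lcoset x M y -> forall n, N n -> union_lcosets cs (n * y)).
  by exists [::] => // y xy _; apply: all.
move=> /existsNP[y0 /not_implyP[xy0 /existsNP[n0 /not_implyP[Nn0 n0y0]]]].
(* Requiring $n_0y$ to lie in a coset of [cs] confines $y$ to finitely many cosets of groups $M\cap
   c.2$. As $n_0y_0$ lies in none of these cosets, [M] is not contained in [c.2] and the measure
   drops. *)
have [|c cin|ls Nls lsP] := seq_gather cs N (fun c ls =>
    forall y, lcoset x M y -> lcoset c.1 c.2 (n0 * y) ->
      (forall l, l \in ls -> union_lcosets cs (l * y)) ->
      forall n, N n -> union_lcosets cs (n * y)).
- by move=> c r r' rr' H y xy cy lsy; apply: H => // l /rr'; apply: lsy.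
- have [[z [xz cz]]|H0] := pselect (exists z, lcoset x M z /\ lcoset c.1 c.2 (n0 * z)); last first.
    by exists [::] => // y xy cy; case: H0; exists y.
  have sc := scs c cin.
  have MNc : ~ M `<=` c.2.
    move=> Mc; apply: n0y0; exists c => //.
    rewrite (lcoset_eq _ _ _ sc cz) /lcoset /=; gsimp.
    by apply: Mc; move: xy0; rewrite (lcoset_eq _ _ _ sM xz).
  have [||ls Nls lsP] := IH z (M `&` c.2); first exact: subgroupI.
    rewrite -ltnS; apply: leq_trans ltk; rewrite ltnS.
    apply: (@count_ltn _ _ _ _ c) => //; last first.
    - by apply/negP => /asboolP; apply; apply: subIsetr.
    - exact/asboolP.
    - by move=> d _ /asboolP nd; apply/asboolP => Md; apply: nd => t [/Md].
  exists ls => // y xy cy; apply: lsP; split.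
    by move: xy; rewrite (lcoset_eq _ _ _ sM xz).
  by move: cy; rewrite (lcoset_eq _ _ _ sc cz) /lcoset /=; gsimp.
exists (n0 :: ls) => [l|y xy lsy].
  by rewrite inE => /orP[/eqP->|/Nls].
have [|c cin cy] := lsy n0; first by rewrite inE eqxx.
by apply: (lsP c cin y xy cy) => l lin; apply: lsy; rewrite inE lin orbT.
Qed.

(** By [noetherian_ltrans] the condition on [y] says that $Ny$ lies in the union. Then [N] is
    covered by the cosets $(c.1\,y^{-1})(y\,c.2\,y^{-1})$, and [neumann_at1] selects one through 1,
    that is, one with $y$ in the original coset. *)
Lemma purge_left N cs : is_subgroup N -> {in cs, forall c, is_subgroup c.2} ->
  exists ls : seq G, [/\ 1 \in ls, {in ls, forall l, N l} &
    forall y, (forall l, l \in ls -> union_lcosets cs (l * y)) ->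
      exists c, [/\ c \in cs, lcoset c.1 c.2 y & almost_sub N (conj c.1 c.2)]].
Proof.
move=> sN scs; have [ls Nls lsP] := noetherian_ltrans N cs scs.
exists (1 :: ls); split=> [|l|y lsy]; first by rewrite inE eqxx.
  by rewrite inE => /orP[/eqP->|/Nls //]; apply: subgroup1.
have [||_ [/mapP[c cin ->] /= c1 Nc]] := neumann_at1 N [seq (c.1 * y^-1, conj y c.2) | c <- cs] sN.
- by move=> _ /mapP[c /scs sc ->]; apply: subgroup_conj.
- move=> n Nn; have [|c cin cy] := lsP y _ n Nn.
    by move=> l lin; apply: lsy; rewrite inE lin orbT.
  exists (c.1 * y^-1, conj y c.2); first exact: (map_f (fun c => (c.1 * y^-1, conj y c.2))).
  by move: cy; rewrite /lcoset /conj /=; gsimp.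
have cy : lcoset c.1 c.2 y by move: c1; rewrite /lcoset /conj /=; gsimp.
by exists c; split=> //; rewrite (conj_lcoset _ _ _ (scs c cin) cy).
Qed.

(* Inversion turns the left coset [c M] into [c^-1 (c M c^-1)]. *)
Lemma purge_right N cs : is_subgroup N -> {in cs, forall c, is_subgroup c.2} ->
  exists ls : seq G, [/\ 1 \in ls, {in ls, forall l, N l} &
    forall y, (forall l, l \in ls -> union_lcosets cs (y * l)) ->
      exists c, [/\ c \in cs, lcoset c.1 c.2 y & almost_sub N c.2]].
Proof.
move=> sN scs; pose ci (c : G * set G) := (c.1^-1, conj c.1 c.2).
have ciP c y : c \in cs -> lcoset (ci c).1 (ci c).2 y^-1 <-> lcoset c.1 c.2 y.
  move=> /scs sc; rewrite /ci /lcoset /conj /=; gsimp.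
  have -> : y^-1 * c.1 = (c.1^-1 * y)^-1 by gsimp.
  by split=> /(subgroupV sc) //; rewrite invgK.
have [|ls [ls1 Nls lsP]] := purge_left N (map ci cs) sN.
  by move=> _ /mapP[c /scs sc ->]; apply: subgroup_conj.
exists (map inv ls); split=> [|_ /mapP[l /Nls Nl ->]|y lsy].
- by apply/mapP; exists 1; rewrite ?invg1.
- exact: subgroupV.
have [l lin|_ [/mapP[c cin ->] cy Nc]] := lsP y^-1.
  have [|c cin cy] := lsy l^-1; first exact: map_f.
  exists (ci c); first exact: map_f.
  by have -> : l * y^-1 = (y * l^-1)^-1 by [gsimp]; apply/ciP.
exists c; split=> //; first exact/ciP.
by move: Nc; rewrite /ci /= conjVK.
Qed.

(** * Small sets *)

Definition small L A : Prop :=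
  covered [set M | is_subgroup M /\ ~ almost_sub L M] A.

Lemma small_almost_sub L L' A : almost_sub L L' -> small L A -> small L' A.
Proof.
move=> LL'; apply: covered_impl => M [sM LM]; split=> // L'M.
by apply: LM; apply: almost_sub_trans L'M.
Qed.

(** Right translation conjugates the covering subgroups by [l], and this conjugation fixes [L]. *)
Lemma small_rtrans L A l : is_subgroup L -> L l -> small L A -> small L (rtrans l A).
Proof.
move=> sL Ll /(covered_rtrans l); apply: covered_impl => _ [M [sM LM] <-].
split; first exact: subgroup_conj.
move=> /(almost_sub_conj l^-1); rewrite conjVK conj_id //; exact: subgroupV.
Qed.

(** Finitely many translates of the coset cover [L], so [L] itself would be small, against Neumann's
    lemma. *)
Lemma not_small_lcoset L L' x : is_subgroup L -> almost_sub L L' ->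
  ~ small L (lcoset x L').
Proof.
move=> sL LL' /(covered_ltrans _ x) sx.
have [cs scs Lcs] : small L L.
  apply: covered_trans LL' _ => _ ->; apply: covered_sub sx => y.
  by rewrite /ltrans /lcoset /=; gsimp.
have [||_ /mapP[c /scs[_ nLc] ->]//] := neumann (map snd cs) L sL.
  by move=> _ /mapP[c /scs[sc _] ->].
by exists cs => // c; apply: map_f.
Qed.

(** Modulo small sets, [A] is a union of left cosets of a subgroup of finite index in [L]. *)
Definition splits L A : Prop := exists L', [/\ is_subgroup L', L' `<=` L,
  almost_sub L L' &
  forall x, small L (lcoset x L' `&` A) \/ small L (lcoset x L' `\` A)].

(** If [L] is not almost contained in [M], the coset is itself small. Otherwise each coset of $L\cap
    M$ lies inside $aM$ or is disjoint from it. *)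
Lemma splits_lcoset L M a : is_subgroup L -> is_subgroup M -> splits L (lcoset a M).
Proof.
move=> sL sM; have [LM|LM] := pselect (almost_sub L M); last first.
  exists L; split=> //; first by apply: sub_almost_sub.
  by move=> x; left; apply: covered_sub (@subIsetr _ _ _) (covered_lcoset _ _ _ _).
exists (L `&` M); split=> [||//|x].
- exact: subgroupI.
- exact: subIsetl.
- by apply: almost_subI => //; apply: sub_almost_sub.
have [[z [xz az]]|H0] := pselect (exists z, (lcoset x (L `&` M) `&` lcoset a M) z).
  right; apply: covered_sub (covered0 _) => y [xy]; apply.
  move: xy; rewrite (lcoset_eq _ _ _ (subgroupI _ _ sL sM) xz) (lcoset_eq _ _ _ sM az).
  by case.
by left; apply: covered_sub (covered0 _) => y Hy; apply: H0; exists y.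
Qed.

Lemma splitsC L A : splits L A -> splits L (~` A).
Proof.
move=> [L' [sL' L'L LL' H]]; exists L'; split=> // x.
by rewrite setDE setCK; case: (H x) => Hx; [right|left].
Qed.

Lemma splitsU L A B : splits L A -> splits L B -> splits L (A `|` B).
Proof.
move=> [M [sM ML LM HM]] [N [sN NL LN HN]]; exists (M `&` N); split.
- exact: subgroupI.
- by move=> x [/ML].
- exact: almost_subI.
move=> x; case: (HM x) (HN x) => [HA|HA] [HB|HB].
- by left; apply: covered_sub (coveredU _ _ _ HA HB) => y [[My Ny] [Ay|By]]; [left|right].
- by right; apply: covered_sub HB => y [[My Ny] /not_orP[nA nB]].
- by right; apply: covered_sub HA => y [[My Ny] /not_orP[nA nB]].
- by right; apply: covered_sub HA => y [[My Ny] /not_orP[nA nB]].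
Qed.

Lemma splits0 L : is_subgroup L -> splits L set0.
Proof.
move=> sL; exists L; split=> //; first exact: sub_almost_sub.
by move=> x; left; rewrite setI0; apply: covered0.
Qed.

Lemma splitsD L A B : splits L A -> splits L B -> splits L (A `\` B).
Proof.
by move=> HA HB; rewrite setDE -[A]setCK -setCU; apply/splitsC/splitsU => //; apply: splitsC.
Qed.

(** Two-sided translates are built into the induction; on generators, $s^{-1}rKt^{-1}$ is the left
    coset of $tKt^{-1}$ based at $s^{-1}rt^{-1}$. *)
Lemma coset_ring_splits A : coset_ring G A ->
  forall s t L, is_subgroup L -> splits L [set y | A (s * y * t)].
Proof.
apply: (smallest_sub (X := [set A | forall s t L, is_subgroup L ->
  splits L [set y | A (s * y * t)]])) A.
  split.
  - by exists set0 => s t L sL; apply: splits0.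
  - by move=> A B HA HB s t L sL; apply: splitsU; [apply: HA|apply: HB].
  - move=> A B HA HB s t L sL; rewrite -[A `&` B]setCK setCI.
    by apply/splitsC/splitsU; apply/splitsC; [apply: HA|apply: HB].
  - by move=> A HA s t L sL; apply/splitsC/HA.
move=> _ [r _ [K sK <-]] s t L sL.
rewrite (_ : mkset _ = lcoset (s^-1 * r * t^-1) (conj t K)).
  by apply: splits_lcoset => //; apply: subgroup_conj.
apply/seteqP; rewrite /lcoset /conj; split=> y /=; gsimp.
  move=> [k Kk ey]; rewrite (_ : r^-1 * s * y * t = k) //.
  by rewrite -!mulgA (mulgA s) -ey; gsimp.
by move=> Ky; eexists; first exact: Ky; gsimp.
Qed.

(** * Subgroups in a translation-invariant ring *)

Lemma setring_seqU {I : eqType} (s : seq I) (A : I -> set G) (B : set (set G)) :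
  setring B -> {in s, forall i, B (A i)} ->
  B [set y | exists2 i, i \in s & A i y].
Proof.
move=> [B0 BU _]; elim: s => [_|i s IH H].
  by rewrite (_ : mkset _ = set0) //; apply/seteqP; split=> y [].
rewrite (_ : mkset _ = A i `|` [set y | exists2 j, j \in s & A j y]).
  apply: BU; first by apply: H; rewrite inE eqxx.
  by apply: IH => j js; apply: H; rewrite inE js orbT.
apply/seteqP; split=> y.
  by move=> [j]; rewrite inE => /orP[/eqP->|js Ay]; [left|right; exists j].
by move=> [Ay|[j js Ay]]; [exists i|exists j]; rewrite // inE ?eqxx ?js ?orbT.
Qed.

(** A relative ring may lack the whole space, so the intersection is formed as a difference inside
    one chosen member [A i0]. *)
Lemma setring_seqI {I : eqType} (s : seq I) i0 (A : I -> set G) (B : set (set G)) :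
  setring B -> i0 \in s -> {in s, forall i, B (A i)} ->
  B [set y | forall i, i \in s -> A i y].
Proof.
move=> rB i0s H; have [_ _ BD] := rB.
rewrite (_ : mkset _ = A i0 `\` [set y | exists2 i, i \in s & (A i0 `\` A i) y]).
  by apply: (BD); [exact: H|apply: setring_seqU => // i /H; apply: (BD); exact: H].
apply/seteqP; split=> y.
  by move=> Ay; split; [exact: Ay|move=> [i /Ay Aiy []]].
by move=> [A0 nA] i si; apply: contrapT => nAi; apply: nA; exists i.
Qed.

Lemma covered_reps L V : is_subgroup L -> covered [set L] V ->
  exists2 X : seq G, {in X, forall x, V x} &
    forall y, V y -> exists2 x, x \in X & lcoset x L y.
Proof.
move=> sL [cs csL Vcs].
have [||X VX XP] := seq_gather cs V (fun c X =>
    forall y, V y -> lcoset c.1 L y -> exists2 x, x \in X & lcoset x L y).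
- by move=> c r r' rr' H y Vy cy; have [x /rr' xr xy] := H y Vy cy; exists x.
- move=> c _; have [[z [cz Vz]]|H0] := pselect (exists z, lcoset c.1 L z /\ V z).
    exists [:: z] => [x|y Vy cy]; first by rewrite inE => /eqP->.
    by exists z; rewrite ?inE // -(lcoset_eq _ _ _ sL cz).
  by exists [::] => // y Vy cy; case: H0; exists y.
exists X => // y Vy; have [c cin cy] := Vcs y Vy; apply: (XP c) => //.
by rewrite -(csL c cin).
Qed.

(* A left-invariant ring contains V as soon as it contains a set A that differs
   from V by a small set: V is invariant under a subgroup N of finite index in
   L, and finitely many N-translates suffice to erase first A \ V, then V \ A. *)
Lemma exactify (B : set (set G)) L L' A V :
  setring B -> (forall g A, B A -> B (ltrans g A)) ->
  is_subgroup L -> is_subgroup L' -> almost_sub L L' ->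
  covered [set L'] V -> (forall v l, V v -> L' l -> V (v * l)) ->
  (forall y, A y \/ V y -> almost_sub L (conj y L) /\ almost_sub (conj y L) L) ->
  B A -> small L (A `+` V) -> B V.
Proof.
move=> rB Bl sL sL' LL' covV VL' comm BA sAV.
have [X VX XP] := covered_reps L' V sL' covV.
(* [N] is obtained from [L] and the groups $xL'x^{-1}$ for finitely many representatives $x$ of [V].
   It has finite index in [L] and leaves [V] invariant on the left, as $nv=v(v^{-1}nv)$. *)
have [|N [sN LN NL NX]] := almost_sub_seqI X (conj^~ L') L sL.
  move=> x /VX Vx; split; first exact: subgroup_conj.
  have [Lx _] := comm x (or_intror Vx).
  by apply: almost_sub_trans Lx _; apply: almost_sub_conj.
have NV n v : N n -> V v -> V (n * v).
  move=> Nn Vv; have [x xX xv] := XP v Vv.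
  have -> : n * v = v * (v^-1 * n * v) by gsimp.
  by apply: VL' => //; have := NX x xX n Nn; rewrite (conj_lcoset _ _ _ sL' xv).
have NV' n v : N n -> V (n * v) -> V v.
  by move=> /(subgroupV sN) Nn /(NV _ _ Nn); rewrite mulKg.
(* Finitely many [N]-translates of a small [D] have empty intersection: a coset of [M] surviving at
   $y\in D$ would give $yLy^{-1}$ almost contained in $yMy^{-1}$, hence [L] almost contained in
   [M]. *)
have purge D : small L D -> D `<=` A `|` V ->
    exists ls : seq G, [/\ 1 \in ls, {in ls, forall l, N l} &
      forall y, exists2 l, l \in ls & ~ D (l * y)].
  move=> [cs scs Dcs] DAV.
  have [|ls [ls1 Nls lsP]] := purge_left N cs sN; first by move=> c /scs[].
  exists ls; split=> // y; apply: contrapT => nD.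
  have lsD l : l \in ls -> D (l * y).
    by move=> lin; apply: contrapT => nDl; apply: nD; exists l.
  have [l lin|c [cin cy Nc]] := lsP y; first exact/Dcs/lsD.
  have [sc nLc] := scs c cin; apply: nLc.
  have Dy : D y by have := lsD _ ls1; rewrite mul1g.
  have [_ yL] := comm y (DAV y Dy).
  have := almost_sub_trans _ _ _ yL (almost_sub_trans _ _ _ LN Nc).
  by rewrite (conj_lcoset _ _ _ sc cy) => /(almost_sub_conj y^-1); rewrite !conjVK.
have [|ls [ls1 Nls lsP]] := purge _ sAV.
  by move=> y [[Ay _]|[Vy _]]; [left|right].
(* Intersecting translates of [A] removes the points outside the [N]-invariant set [V], while
   $V\setminus A_1$ stays small. A union of translates of [A1] then fills [V]. *)
pose A1 := [set y | forall l, l \in ls -> ltrans l A y].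
have BA1 : B A1 by apply: setring_seqI rB ls1 _ => l _; apply: (Bl).
have A1V : A1 `<=` V.
  move=> y A1y; apply: contrapT => nVy; have [l lin] := lsP y; apply; left.
  by split; [exact: A1y|move=> /(NV' _ _ (Nls l lin))].
have [||ms [ms1 Nms msP]] := purge (V `\` A1).
- apply: covered_sub (covered_seq ls _ (fun l => ltrans l (A `+` V)) _); last first.
    by move=> l _; apply: covered_ltrans.
  move=> y [Vy /existsNP[l /not_implyP[lin nAl]]]; exists l => //; right.
  by split=> //; apply: (NV) => //; apply: Nls.
- by move=> y [Vy _]; right.
rewrite (_ : V = [set y | exists2 m, m \in ms & ltrans m A1 y]).
  by apply: setring_seqU => // m _; apply: (Bl).
apply/seteqP; split=> y; last by move=> [m /Nms Nm /A1V]; apply: NV'.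
move=> Vy; have [m min nD] := msP y; exists m => //; apply: contrapT => nA.
by apply: nD; split=> //; apply: (NV) => //; apply: Nms.
Qed.

Definition lcosets (W : seq G) L : set G :=
  [set y | exists2 w, w \in W & lcoset w L y].

Lemma covered_lcosets W L : covered [set L] (lcosets W L).
Proof. by apply: covered_seq => w _; apply: covered_lcoset. Qed.

Lemma lcosets_filter W L (S : set G) : is_subgroup L ->
  (forall y l, S y -> L l -> S (y * l)) ->
  lcosets W L `&` S = lcosets [seq w <- W | `[< S w >]] L.
Proof.
move=> sL SL; have SE w y : lcoset w L y -> S w <-> S y.
  move=> wy; split=> [Sw|Sy]; first by rewrite -(mulVKg w y); apply: SL.
  rewrite (_ : w = y * (w^-1 * y)^-1); last by gsimp.
  by apply: SL => //; apply: subgroupV.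
apply/seteqP; split=> [y [[w wW wy] Sy]|y [w]].
  by exists w => //; rewrite mem_filter wW andbT; apply/asboolP/(SE _ y).
rewrite mem_filter => /andP[/asboolP Sw wW] wy.
by split; [exists w|apply/(SE w)].
Qed.

Lemma covered_lcosetsE L V : is_subgroup L -> covered [set L] V ->
  (forall v l, V v -> L l -> V (v * l)) -> exists W, V = lcosets W L.
Proof.
move=> sL covV VL; have [W VW WP] := covered_reps L V sL covV; exists W.
apply/seteqP; split=> [y /WP //|y [w /VW Vw wy]].
by rewrite -(mulVKg w y); apply: VL.
Qed.

(* If all left translates of V are disjoint from V or contain V, then V is a
   coset; otherwise some translate cuts V into two smaller members of B. *)
Lemma union_subgroup_cosets (B : set (set G)) L W :
  setring B -> (forall g A, B A -> B (ltrans g A)) -> is_subgroup L ->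
  B (lcosets W L) ->
  exists2 ks, {in ks, forall k, [/\ is_subgroup k.2, B k.2,
    almost_sub k.2 L & almost_sub L k.2]} & lcosets W L = union_lcosets ks.
Proof.
move=> rB Bl sL; have [B0 BU BD] := rB.
have [n] := ubnP (size W); elim: n W => // n IH W ltW BV.
set V := lcosets W L in BV *.
have VL y l : V y -> L l -> V (y * l).
  move=> [w wW wy] Ll; exists w => //; rewrite /lcoset /= mulgA.
  exact: subgroupM.
have [[g [[y1 [Vy1 gy1]] [y2 [Vy2 gy2]]]]|H] := pselect (exists g,
  (exists y, V y /\ V (g * y)) /\ (exists y, V y /\ ~ V (g * y))).
  have SL (y l : G) : V (g * y) -> L l -> V (g * (y * l)).
    by rewrite mulgA; apply: (VL).
  have SL' (y l : G) : ~ V (g * y) -> L l -> ~ V (g * (y * l)).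
    move=> nV Ll; rewrite mulgA => /VL /(_ (subgroupV sL _ Ll)).
    by rewrite mulgK.
  pose W1 := [seq w <- W | `[< V (g * w) >]].
  pose W2 := [seq w <- W | `[< ~ V (g * w) >]].
  have E1 : V `&` ltrans g V = lcosets W1 L by apply: lcosets_filter.
  have E2 : V `\` ltrans g V = lcosets W2 L by apply: lcosets_filter.
  have ltW1 : size W1 < size W.
    have : lcosets W2 L y2 by rewrite -E2.
    move=> [w + _]; rewrite mem_filter => /andP[/asboolP nV wW].
    rewrite size_filter -(count_predT W); apply: (@count_ltn _ _ _ _ w) => //.
    by apply/negP => /asboolP.
  have ltW2 : size W2 < size W.
    have : lcosets W1 L y1 by rewrite -E1.
    move=> [w + _]; rewrite mem_filter => /andP[/asboolP Vw wW].
    rewrite size_filter -(count_predT W); apply: (@count_ltn _ _ _ _ w) => //.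
    by apply/negP => /asboolP.
  have [||ks1 ks1P K1] := IH W1; first exact: leq_trans ltW1 ltW.
    by rewrite -E1 -setDD; apply: (BD) => //; apply: (BD) => //; apply: (Bl).
  have [||ks2 ks2P K2] := IH W2; first exact: leq_trans ltW2 ltW.
    by rewrite -E2; apply: (BD) => //; apply: (Bl).
  exists (ks1 ++ ks2) => [k|].
    by rewrite mem_cat => /orP[/ks1P|/ks2P].
  rewrite -[LHS](setUIDK V (ltrans g V)) E1 E2 K1 K2.
  apply/seteqP; split=> y.
    by move=> [[k kin ky]|[k kin ky]]; exists k; rewrite // mem_cat kin ?orbT.
  by move=> [k]; rewrite mem_cat => /orP[kin ky|kin ky]; [left|right]; exists k.
have [[v Vv]|V0] := pselect (exists v, V v); last first.
  by exists [::] => //; apply/seteqP; split=> [y Vy|y []//]; case: V0; exists y.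
have gV g y z : V y -> V (g * y) -> V z -> V (g * z).
  move=> Vy Vgy Vz; apply: contrapT => nV; apply: H; exists g.
  by split; [exists y|exists z].
(* The translation $g=vy^{-1}v^{-1}$ sends $vy\in V$ to $v\in V$, so it preserves [V] and sends $vx$
   to $vy^{-1}x$. This makes $v^{-1}V$ a subgroup. *)
have KF x y : V (v * y) -> V (v * x) -> V (v * (y^-1 * x)).
    have := gV (v * y^-1 * v^-1) (v * y) (v * x).
    by gsimp => gVxy Vy; apply: gVxy.
have sK : is_subgroup (ltrans v V).
  have V1 : V (v * 1) by rewrite mulg1.
  apply: is_subgroupP => //= x y Vx Vy; rewrite /ltrans /= in Vx Vy *.
  rewrite -[x]invgK; apply: (KF); rewrite -[_^-1]mulg1; exact: KF.
exists [:: (v, ltrans v V)] => [k|].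
  rewrite inE => /eqP->; split=> //=; first exact: Bl.
    by apply: covered_ltrans; apply: covered_lcosets.
  by apply: sub_almost_sub => l Ll; rewrite /ltrans /=; apply: (VL).
apply/seteqP; split=> y.
  by move=> Vy; exists (v, ltrans v V); rewrite ?inE // /lcoset /ltrans /= mulVKg.
by move=> [k]; rewrite inE => /eqP->; rewrite /lcoset /ltrans /= mulVKg.
Qed.

(** Otherwise the dichotomy makes [A] small on each of the finitely many cosets of [L'] involved,
    hence small. *)
Lemma not_small_coset L L' A E W : is_subgroup L' -> almost_sub L L' ->
  (forall x, small L (lcoset x L' `&` A) \/ small L (lcoset x L' `\` A)) ->
  A `<=` lcosets W L `|` E -> small L E -> ~ small L A ->
  exists2 x, lcosets W L x & small L (lcoset x L' `\` A).
Proof.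
move=> sL' LL' dich AWE sE nsA; apply: contrapT => H; apply: nsA.
apply: (@covered_sub _ _ ((lcosets W L `&` A) `|` E)).
  by move=> y Ay; case: (AWE y Ay) => [Wy|Ey]; [left|right].
apply: coveredU sE; apply: (covered_local L') => //.
  by apply: covered_trans (covered_lcosets W L) _ => _ ->.
by move=> y Wy Ay; case: (dich y) => // sy; case: H; exists y.
Qed.

(** Right translations by [L'] purge the cosets that cover [E], because a subgroup almost containing
    [L'] almost contains [L]. They preserve each coset of [L'], so one that lies in [A] up to a
    small set also lies in the result up to a small set. *)
Lemma erase_small (B : set (set G)) L A E W :
  setring B -> (forall g A, B A -> B (rtrans g A)) ->
  is_subgroup L -> splits L A -> B A ->
  A `<=` lcosets W L `|` E -> small L E -> ~ small L A ->
  exists A', [/\ B A', ~ small L A' & A' `<=` lcosets W L].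
Proof.
move=> rB Br sL [L' [sL' L'L LL' dich]] BA AWE sE nsA.
have [x Wx sx] := not_small_coset _ _ _ _ _ sL' LL' dich AWE sE nsA.
have [es ses Ees] := sE.
have [|ls [ls1 L'ls lsP]] := purge_right L' ([seq (w, L) | w <- W] ++ es) sL'.
  by move=> c; rewrite mem_cat => /orP[/mapP[w _ ->]//|/ses[]].
pose A' := [set y | forall l, l \in ls -> rtrans l A y].
exists A'; split.
- by apply: setring_seqI rB ls1 _ => l _; apply: Br.
- move=> sA'; apply: (not_small_lcoset L L' x sL LL').
  apply: (@covered_sub _ _ (A' `|`
      [set y | exists2 l, l \in ls & rtrans l (lcoset x L' `\` A) y])).
    move=> y xy; have [A'y|] := pselect (A' y); first by left.
    move=> /existsNP[l /not_implyP[lin nA]]; right; exists l => //; split=> //.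
    by rewrite /lcoset /= mulgA; apply: subgroupM => //; apply: L'ls.
  apply: coveredU sA' _; apply: covered_seq => l lin.
  by apply: small_rtrans => //; apply/L'L/L'ls.
- move=> y A'y; have [|c [+ cy Lc]] := lsP y.
    move=> l /A'y /AWE [[w wW wy]|/Ees[e ein ey]].
      by exists (w, L) => //; rewrite mem_cat (map_f (fun w => (w, L))).
    by exists e; rewrite // mem_cat ein orbT.
  rewrite mem_cat => /orP[/mapP[w wW ec]|/ses[_ []]].
    by exists w => //; move: cy; rewrite ec.
  exact: almost_sub_trans Lc.
Qed.

(* Among the non-small members of B covered by finitely many left cosets of L,
   take one, A, for which the number of cosets is least. Right translations show
   that A meets each of these cosets w L in a non-small set, and then left
   translations show that the groups w L w^-1 are pairwise commensurable. *)
Lemma commensurable_subgroup (B : set (set G)) L A E W :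
  setring B -> (forall g A, B A -> B (ltrans g A)) ->
  (forall g A, B A -> B (rtrans g A)) -> (forall A, B A -> splits L A) ->
  is_subgroup L -> B A -> A `<=` lcosets W L `|` E -> small L E -> ~ small L A ->
  exists K, [/\ is_subgroup K, B K, almost_sub K L & almost_sub L K].
Proof.
move=> rB Bl Br Bs sL BA0 AWE0 sE0 nsA0.
have [A1 []] := erase_small B L A E W rB Br sL (Bs _ BA0) BA0 AWE0 sE0 nsA0.
move: A1 => {E BA0 AWE0 sE0 nsA0}A BA nsA AW.
have [n] := ubnP (size W); elim: n W A BA nsA AW => // n IH W A BA nsA AW ltW.
apply: contrapT => noK.
have minW W' A' : size W' < size W -> B A' -> A' `<=` lcosets W' L -> small L A'.
  move=> ltW' BA' AW'; apply: contrapT => nsA'; apply: noK.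
  exact: IH BA' nsA' AW' (leq_trans ltW' ltW).
have [L' [sL' L'L LL' dich]] := Bs A BA.
have AW0 : A `<=` lcosets W L `|` set0 by rewrite setU0.
(* [A'] is cut out of $x^{-1}A$ by left translations by elements of [L']. It contains [L'] up to a
   small set, so it is not small, and by minimality the coset of [b] cannot have been purged. *)
have left x b : small L (lcoset x L' `\` A) -> b \in W -> almost_sub (conj x L) (conj b L).
  move=> sx bW.
  have [|ls [ls1 L'ls lsP]] := purge_left L' [seq (x^-1 * w, L) | w <- W] sL'.
    by move=> _ /mapP[w _ ->].
  pose A' := [set y | forall l, l \in ls -> ltrans (x * l) A y].
  have BA' : B A' by apply: setring_seqI rB ls1 _ => l _; apply: Bl.
  pose W' := [seq w <- W | `[< almost_sub L' (conj (x^-1 * w) L) >]].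
  have AW' : A' `<=` lcosets [seq x^-1 * w | w <- W'] L.
    move=> y A'y; have [|_ [/mapP[w wW ->] wy Lw]] := lsP y.
      move=> l /A'y /AW[w wW wy]; exists (x^-1 * w, L).
        exact: (map_f (fun w => (x^-1 * w, L))).
      by move: wy; rewrite /lcoset /=; gsimp.
    exists (x^-1 * w) => //; apply: map_f; rewrite mem_filter wW andbT.
    exact/asboolP.
  have nsA' : ~ small L A'.
    move=> sA'; apply: (not_small_lcoset L L' 1 sL LL').
    apply: (@covered_sub _ _ (A' `|`
        [set y | exists2 l, l \in ls & ltrans (x * l) (lcoset x L' `\` A) y])).
      move=> y; rewrite /lcoset /= invg1 mul1g => L'y.
      have [A'y|] := pselect (A' y); first by left.
      move=> /existsNP[l /not_implyP[lin nA]]; right; exists l => //; split=> //.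
      by rewrite /lcoset /=; gsimp; apply: subgroupM => //; apply: L'ls.
    apply: coveredU sA' _; apply: covered_seq => l lin.
    exact: covered_ltrans.
  have LW : almost_sub L' (conj (x^-1 * b) L).
    apply: contrapT => nb; apply: nsA'; apply: minW AW' => //.
    rewrite size_map size_filter -(count_predT W).
    by apply: (@count_ltn _ _ _ _ b) => //; apply/negP => /asboolP.
  apply/almost_sub_conjl; rewrite -conjM; exact: almost_sub_trans LW.
(* $A\cap aL$ is not small, for otherwise [erase_small] would dispense with $aL$. Hence $aL$
   contains a coset of [L'] lying in [A] up to a small set, and [left] applies to it. *)
have comm a b : a \in W -> b \in W -> almost_sub (conj a L) (conj b L).
  move=> aW bW.
  have nsa : ~ small L (lcoset a L `&` A).
    move=> sa; have [|A' [BA' nsA' AW']] :=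
        erase_small B L A (lcoset a L `&` A) [seq w <- W | w != a] rB Br sL (Bs _ BA) BA _ sa nsA.
      move=> y Ay; have [w wW wy] := AW y Ay; have [ewa|nwa] := eqVneq w a.
        by right; rewrite -ewa.
      by left; exists w; rewrite // mem_filter nwa.
    apply: nsA'; apply: minW AW' => //.
    rewrite size_filter -(count_predT W).
    by apply: (@count_ltn _ _ _ _ a) => //=; rewrite eqxx.
  suff [x ax sx] : exists2 x, lcoset a L x & small L (lcoset x L' `\` A).
    by rewrite (conj_lcoset _ _ _ sL ax); apply: left.
  apply: contrapT => H; apply: nsa; apply: (covered_local L') => //.
    by apply: covered_trans (covered_lcoset [set L] a L _) _ => // _ ->.
  by move=> y ay Ay; case: (dich y) => // sy; case: H; exists y.
have [x0 [w0 w0W w0x0] sx0] := not_small_coset _ _ _ _ _ sL' LL' dich AW0 (covered0 _) nsA.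
pose V := [set y | lcosets W L y /\ small L (lcoset y L' `\` A)].
have covW : covered [set L'] (lcosets W L).
  by apply: covered_trans (covered_lcosets W L) _ => _ ->.
have sAV : small L (A `+` V).
  apply: coveredU.
    apply: (@covered_sub _ _ (lcosets W L `&` (A `\` V))).
      by move=> y [Ay nVy]; split=> //; apply: AW.
    apply: (covered_local L') => // y Wy [Ay nVy]; case: (dich y) => [|sy].
      by apply: covered_sub => z [? []].
    by case: nVy.
  apply: (@covered_sub _ _ (lcosets W L `&` (V `\` A))).
    by move=> y [[Wy sy] nA].
  apply: (covered_local L') => // y Wy [[_ sy] _].
  by apply: covered_sub sy => z [? []].
(* After translation by $w_0^{-1}$, the conjugates of [L] by points of the sets compared are
   commensurable with [L] itself, as [exactify] requires. *)
have covV : covered [set L'] (ltrans w0 V).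
  by apply: covered_ltrans; apply: covered_sub covW => y [].
have VL' v l : ltrans w0 V v -> L' l -> ltrans w0 V (v * l).
  move=> [[w wW wv] sv] L'l; split.
    exists w => //; move: wv; rewrite /lcoset /= !mulgA => wv.
    by apply: subgroupM => //; apply: L'L.
  rewrite -(lcoset_eq (w0 * v) (w0 * (v * l)) L') //.
  by rewrite /lcoset /=; gsimp.
have BV : B (ltrans w0 V).
  apply: (exactify B L L' (ltrans w0 A)) => //.
  - move=> y w0y; have [w wW wy] : lcosets W L (w0 * y).
      by case: w0y => [/AW|[]].
    have E : conj w L = conj w0 (conj y L).
      by rewrite -conjM; apply: conj_lcoset.
    split.
      by have := comm w0 w w0W wW; rewrite E => /(almost_sub_conj w0^-1); rewrite !conjVK.
    by have := comm w w0 wW w0W; rewrite E => /(almost_sub_conj w0^-1); rewrite !conjVK.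
  - exact: Bl.
  - exact: (covered_ltrans _ w0 (A `+` V)).
have [X EX] := covered_lcosetsE L' (ltrans w0 V) sL' covV VL'.
rewrite EX in BV; have [ks ksP Eks] := union_subgroup_cosets B L' X rB Bl sL' BV.
have : ltrans w0 V (w0^-1 * x0) by rewrite /ltrans /= mulVKg; split=> //; exists w0.
rewrite EX Eks => -[k /ksP[sk Bk kL' L'k] _]; apply: noK; exists k.2; split=> //.
  by apply: almost_sub_trans kL' _; apply: sub_almost_sub.
exact: almost_sub_trans L'k.
Qed.

(** * Induction on the subgroups involved *)

Lemma setringY (B : set (set G)) A V : setring B -> B A -> B V -> B (A `+` V).
Proof. by move=> [_ BU BD] BA BV; apply: BU; apply: (BD). Qed.

Lemma notin_setY A V y : ~ (A `+` V) y -> A y = V y.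
Proof.
rewrite /setY /= => nAV; apply/propext.
by have [Ay|nAy] := pselect (A y); have [Vy|nVy] := pselect (V y); tauto.
Qed.

Lemma setring_capr (B : set (set G)) E : setring B -> setring [set A | B (A `&` E)].
Proof.
move=> [B0 BU BD]; split=> [|A V BA BV|A V BA BV] /=; first by rewrite set0I.
  by rewrite setIUl; apply: BU.
rewrite (_ : _ `&` E = (A `&` E) `\` (V `&` E)); first exact: BD.
by apply/seteqP; split=> y /=; tauto.
Qed.

Definition commensurable M N := almost_sub M N /\ almost_sub N M.

(** Asking only for commensurability lets subgroups of finite index be taken without changing [F],
    whose length measures the final induction. *)
Definition comm_cosets (F : seq (set G)) : set (set G) :=
  [set A | exists x M, [/\ is_subgroup M,
     exists2 P, P \in F & commensurable M P & A = lcoset x M]].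

Definition comm_ring F : set (set G) := <<r comm_cosets F >>.

Lemma comm_ring_mono (F F' : seq (set G)) :
  {subset F <= F'} -> comm_ring F `<=` comm_ring F'.
Proof.
move=> FF'; apply: sub_setring2 => _ [x [M [sM [P PF MP] ->]]].
by exists x, M; split=> //; exists P => //; apply: FF'.
Qed.

Lemma comm_ring_covered F A : comm_ring F A ->
  covered [set M | is_subgroup M /\ exists2 P, P \in F & commensurable M P] A.
Proof.
set Q := (X in covered X); apply: (smallest_sub (X := covered Q)) A.
  split; first exact: covered0.
    by move=> A V; apply: coveredU.
  by move=> A V cA _; apply: covered_sub cA => y [].
by move=> _ [x [M [sM FM ->]]]; apply: covered_lcoset.
Qed.

Definition inter_closed (F : seq (set G)) :=
  {in F &, forall M N, M `&` N \in F}.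

Definition below L (F : seq (set G)) := [seq M <- F | `[< ~ almost_sub L M >]].

Lemma mem_below L F M : M \in below L F -> M \in F /\ ~ almost_sub L M.
Proof. by rewrite mem_filter => /andP[/asboolP ? ?]. Qed.

Lemma below_inter_closed L F : inter_closed F -> inter_closed (below L F).
Proof.
move=> cF M N /mem_below[MF LM] /mem_below[NF _]; rewrite mem_filter cF // andbT.
apply/asboolP => LMN; apply: LM; apply: almost_sub_trans LMN _.
by apply: sub_almost_sub; apply: subIsetl.
Qed.

(** This is an ideal property. A non-empty intersection of cosets of [M] and [N] is a coset of
    $M\cap N$, which is commensurable with $P\cap Q\in F$; and $P\cap Q$ does not almost contain [L]
    because [Q] does not. *)
Lemma comm_ring_below L F A E :
  {in F, forall M, is_subgroup M} -> inter_closed F ->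
  comm_ring F A -> comm_ring (below L F) E -> comm_ring (below L F) (A `&` E).
Proof.
move=> sF cF; set R := comm_ring (below L F).
have rR : setring R by apply: smallest_setring.
move=> CA; rewrite setIC.
move: E; apply: (smallest_sub (X := [set E | R (E `&` A)])); first exact: setring_capr.
move=> _ [y [N [sN [Q QF NQ] ->]]] /=; rewrite setIC.
move: A CA; apply: (smallest_sub (X := [set A | R (A `&` lcoset y N)])).
  exact: setring_capr.
move=> _ [x [M [sM [P PF MP] ->]]] /=.
have [[z [xz yz]]|H0] := pselect (exists z, (lcoset x M `&` lcoset y N) z); last first.
  rewrite (_ : _ `&` _ = set0); first by case: rR.
  by apply/seteqP; split=> z // Hz; case: H0; exists z.
rewrite (lcoset_eq _ _ _ sM xz) (lcoset_eq _ _ _ sN yz).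
apply: sub_gen_smallest; exists z, (M `&` N); split=> //; first exact: subgroupI.
have [QF' LQ] := mem_below _ _ _ QF; exists (P `&` Q).
  rewrite mem_filter cF // andbT; apply/asboolP => LPQ; apply: LQ.
  by apply: almost_sub_trans LPQ _; apply: sub_almost_sub; apply: subIsetr.
case: MP NQ => MP PM [NQ QN].
have [sP sQ] := (sF P PF, sF Q QF').
split; apply: almost_subI => //.
- by apply: almost_sub_trans MP; apply: sub_almost_sub; apply: subIsetl.
- by apply: almost_sub_trans NQ; apply: sub_almost_sub; apply: subIsetr.
- by apply: almost_sub_trans PM; apply: sub_almost_sub; apply: subIsetl.
- by apply: almost_sub_trans QN; apply: sub_almost_sub; apply: subIsetr.
Qed.

(** Modulo the ideal [comm_ring (below L F)], a generator vanishes or, by maximality of [L], is a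
    coset of a subgroup commensurable with [L]. Unions and differences of such leading parts are
    handled by intersecting the two subgroups. *)
Lemma comm_ring_leading L F : {in F, forall M, is_subgroup M} -> inter_closed F ->
  {in F, forall M, almost_sub L M -> almost_sub M L} ->
  L \in F ->
  forall A, comm_ring F A -> exists L0 V, [/\ is_subgroup L0, commensurable L0 L,
    covered [set L0] V, forall v l, V v -> L0 l -> V (v * l) &
    comm_ring (below L F) (A `+` V)].
Proof.
move=> sF cF maxL LF.
have rF : setring (comm_ring F) by apply: smallest_setring.
have rF' : setring (comm_ring (below L F)) by apply: smallest_setring.
have F'F : comm_ring (below L F) `<=` comm_ring F.
  by apply: comm_ring_mono => M /mem_below[].
pose R A := exists L0 V, [/\ is_subgroup L0, commensurable L0 L,
    covered [set L0] V, forall v l, V v -> L0 l -> V (v * l) &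
    comm_ring (below L F) (A `+` V)].
have R0 A : comm_ring (below L F) A -> R A.
  move=> RA; exists L, set0; split=> //; first exact: sF.
  - by split; apply: sub_almost_sub.
  - exact: covered0.
  - by rewrite setY0.
(* Union and difference are treated together as a pointwise connective; [op_or] keeps the new
   leading part inside $V_1\cup V_2$, hence covered by finitely many cosets. *)
have Rop (op : Prop -> Prop -> Prop) A1 A2 : (forall p q, op p q -> p \/ q) ->
    (forall B : set (set G), setring B -> forall A A', B A -> B A' ->
      B [set y | op (A y) (A' y)]) ->
    comm_ring F A1 -> comm_ring F A2 -> R A1 -> R A2 ->
    R [set y | op (A1 y) (A2 y)].
  move=> op_or opB CA1 CA2 [L1 [V1 [sL1 [L1L LL1] cV1 VL1 RV1]]].
  move=> [L2 [V2 [sL2 [L2L LL2] cV2 VL2 RV2]]].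
  have CV1 : comm_ring F V1.
    by rewrite -[V1]set0Y -(setYK A1) -setYA; apply: (setringY (comm_ring F)) => //; apply: F'F.
  have CV2 : comm_ring F V2.
    by rewrite -[V2]set0Y -(setYK A2) -setYA; apply: (setringY (comm_ring F)) => //; apply: F'F.
  have sN := subgroupI _ _ sL1 sL2.
  have L1N : almost_sub L1 (L1 `&` L2).
    by apply: almost_subI => //; [apply: sub_almost_sub|apply: almost_sub_trans L1L LL2].
  have L2N : almost_sub L2 (L1 `&` L2).
    by apply: almost_subI => //; [apply: almost_sub_trans L2L LL1|apply: sub_almost_sub].
  exists (L1 `&` L2), [set y | op (V1 y) (V2 y)]; split=> //.
  - split; first by apply: almost_sub_trans L1L; apply: sub_almost_sub; apply: subIsetl.
    exact: almost_sub_trans LL1 L1N.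
  - apply: (@covered_sub _ _ (V1 `|` V2)); first by move=> y /op_or.
    by apply: coveredU; [apply: covered_trans cV1 _|apply: covered_trans cV2 _] => _ ->.
  - move=> v l /= opv [L1l L2l].
    have -> : V1 (v * l) = V1 v.
      by apply/propext; split=> [/VL1 /(_ (subgroupV sL1 _ L1l))|/VL1]; rewrite ?mulgK //; apply.
    have -> // : V2 (v * l) = V2 v.
      by apply/propext; split=> [/VL2 /(_ (subgroupV sL2 _ L2l))|/VL2]; rewrite ?mulgK //; apply.
  (* Off the two error terms each $A_i$ agrees with $V_i$, so intersecting with their union changes
     nothing and the ideal property applies. *)
  - rewrite (_ : _ `+` _ = ([set y | op (A1 y) (A2 y)] `+` [set y | op (V1 y) (V2 y)])
        `&` ((A1 `+` V1) `|` (A2 `+` V2))).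
      apply: comm_ring_below => //.
        by apply: (setringY (comm_ring F)) => //; apply: (opB _ rF).
      by case: rF' => _ + _; apply.
    rewrite setIidl // => y opy; apply: contrapT => nAV.
    have e1 : A1 y = V1 y by apply: notin_setY => AVy; apply: nAV; left.
    have e2 : A2 y = V2 y by apply: notin_setY => AVy; apply: nAV; right.
    by move: opy; rewrite /setY /= e1 e2; tauto.
(* Membership in [comm_ring F] is carried through the induction because [Rop] requires it. *)
move=> A CA; suff [] : (comm_ring F `&` R) A by [].
move: A CA; apply: smallest_sub.
  split.
  - by split; [case: rF|apply: R0; case: rF'].
  - move=> A1 A2 [C1 RA1] [C2 RA2]; split; first by case: rF => _ + _; apply.
    by apply: (Rop or) => // B [_ + _] A A'; apply.
  - move=> A1 A2 [C1 RA1] [C2 RA2]; split; first by case: rF => _ _; apply.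
    apply: (Rop (fun p q => p /\ ~ q)) => // [p q []|B [_ _ +] A A']; first by left.
    by apply.
move=> C /[dup] FC [x [M [sM [P PF [MP PM]] EC]]]; split; first exact: sub_gen_smallest.
have [LP|LP] := pselect (almost_sub L P).
  exists M, C; rewrite EC; split=> //.
  - by split; [apply: almost_sub_trans MP _; apply: maxL|apply: almost_sub_trans LP PM].
  - exact: covered_lcoset.
  - by move=> v l xv Ml; rewrite /lcoset /= mulgA; apply: subgroupM.
  - by rewrite setYK; case: rF'.
apply: R0; apply: sub_gen_smallest; exists x, M; split=> //; exists P => //.
by rewrite mem_filter PF andbT; apply/asboolP.
Qed.

Lemma exists_maximal (F : seq (set G)) M0 : M0 \in F ->
  exists2 L, L \in F & {in F, forall M, almost_sub L M -> almost_sub M L}.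
Proof.
elim: F M0 => // M [_ _ _|N F IH _ _].
  by exists M => [|N]; rewrite inE // => /eqP->.
have [|L LF maxL] := IH N; first by rewrite inE eqxx.
have [LM|LM] := pselect (almost_sub L M).
  exists M; first by rewrite inE eqxx.
  move=> N'; rewrite inE => /orP[/eqP-> //|N'F] MN'.
  apply: (almost_sub_trans _ L _ _ LM); apply: maxL => //.
  exact: almost_sub_trans LM MN'.
exists L; first by rewrite inE LF orbT.
by move=> N'; rewrite inE => /orP[/eqP->|/maxL].
Qed.

Lemma lcoset_image x M : [set x * y | y in M] = lcoset x M.
Proof.
apply/seteqP; split=> [_ [y My <-]|y xy]; first by rewrite /lcoset /= mulKg.
by exists (x^-1 * y); rewrite ?mulVKg.
Qed.

(* The part V of A that is made of cosets of a maximal subgroup lies in B, and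
   A `+` V involves fewer subgroups. *)
Lemma sub_left_ring (B : set (set G)) F A :
  setring B -> (forall g A, B A -> B (ltrans g A)) ->
  (forall g A, B A -> B (rtrans g A)) -> (forall L A, is_subgroup L -> B A -> splits L A) ->
  {in F, forall M, is_subgroup M} -> inter_closed F ->
  B A -> comm_ring F A -> left_ring [set K | is_subgroup K /\ B K] A.
Proof.
move=> rB Bl Br Bs; set T := left_ring _.
have rT : setring T by apply: smallest_setring.
have [n] := ubnP (size F); elim: n F A => // n IH F A ltF sF cF BA CA.
case: F => [|M0 F0] in ltF sF cF CA *.
  have -> : A = set0; last by case: rT.
  move=> {BA}; move: A CA; apply: (smallest_sub (X := [set set0])).
    by split=> // [A V|A V] /= -> ->; rewrite ?setU0 ?setD0.
  by move=> A [x [M [_ []]]].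
set F := M0 :: F0 in ltF sF cF CA *.
have [|L LF maxL] := exists_maximal F M0; first by rewrite inE eqxx.
have [L0 [V [sL0 [L0L LL0] cV VL0 CAV]]] := comm_ring_leading _ _ sF cF maxL LF _ CA.
have sAV : small L0 (A `+` V).
  apply: covered_impl (comm_ring_covered _ _ CAV) => M [sM [P /mem_below[PF LP] [MP _]]].
  split=> // L0M; apply: LP; apply: almost_sub_trans MP.
  exact: almost_sub_trans L0M.
have BV : B V.
  have [[v Vv]|V0] := pselect (exists v, V v); last first.
    rewrite (_ : V = set0); first by case: rB.
    by apply/seteqP; split=> y // Vy; case: V0; exists y.
  have [W EW] := covered_lcosetsE _ _ sL0 cV VL0.
  have [||K [sK BK KL0 L0K]] := commensurable_subgroup B L0 A (A `+` V) W rB Bl Br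
      (fun A => Bs L0 A sL0) sL0 BA _ sAV.
  - by rewrite -EW => y Ay; have [Vy|nVy] := pselect (V y); [left|right; left].
  (* If [A] were small, so would be [V] and the coset $vL_0$ inside it. *)
  - move=> sA; apply: (not_small_lcoset L0 L0 v sL0); first exact: sub_almost_sub.
    apply: covered_sub (coveredU _ _ _ sA sAV) => y vy.
    have Vy : V y by rewrite -(mulVKg v y); apply: VL0.
    by have [Ay|nAy] := pselect (A y); [left|right; right].
  have cVK : covered [set K] V by apply: covered_trans cV _ => _ ->.
  have [X VX XP] := covered_reps K V sK cVK.
  (* Inside [K] the commensurability hypothesis of [exactify] is immediate, since $yKy^{-1}=K$ for
     $y\in K$. Translating back, the pieces $V\cap xK$ reassemble [V]. *)
  have BX x : B (ltrans x V `&` K).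
    apply: (exactify B K (K `&` L0) (ltrans x A `&` K)) => //.
    - exact: subgroupI.
    - by apply: almost_subI => //; apply: sub_almost_sub.
    - apply: (@covered_sub _ _ K) => //.
      by apply: almost_subI => //; apply: sub_almost_sub.
    - move=> v' l [Vv' Kv'] [Kl L0l]; split; last exact: subgroupM.
      by rewrite /ltrans /= mulgA; apply: VL0.
    - move=> y H; have Ky : K y by case: H => -[].
      by rewrite conj_id //; split; apply: sub_almost_sub.
    - by apply: setring_setI_closed => //; apply: Bl.
    - apply: covered_sub (covered_ltrans _ x _ (small_almost_sub _ _ _ L0K sAV)) => y.
      by rewrite /ltrans /setY /=; tauto.
  rewrite (_ : V = [set y | exists2 x, x \in X & ltrans x^-1 (ltrans x V `&` K) y]).
    by apply: setring_seqU => // x _; apply: Bl.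
  apply/seteqP; split=> y; last by move=> [x _ []]; rewrite /ltrans /= mulVKg.
  by move=> Vy; have [x xX xy] := XP y Vy; exists x => //; split; rewrite /ltrans /= ?mulVKg.
have TV : T V.
  have [W EW] := covered_lcosetsE _ _ sL0 cV VL0.
  rewrite EW in BV *; have [ks ksP ->] := union_subgroup_cosets B L0 W rB Bl sL0 BV.
  apply: setring_seqU => // k /ksP[sk Bk _ _]; apply: sub_gen_smallest.
  by exists k.1 => //; exists k.2 => //; rewrite lcoset_image.
have TAV : T (A `+` V).
  apply: (IH (below L F)) => //.
  - rewrite -ltnS; apply: leq_trans ltF; rewrite ltnS size_filter -(count_predT F).
    apply: (@count_ltn _ _ _ _ L) => //; apply/negP => /asboolP; apply.
    exact: sub_almost_sub.
  - by move=> M /mem_below[/sF].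
  - exact: below_inter_closed.
  - exact: (setringY B).
by rewrite -[A]setY0 -(setYK V) setYA; apply: (setringY T).
Qed.

(** * From the coset ring and the translates of [Y] to the hypotheses of the induction *)

Lemma inter_closure (F : seq (set G)) : {in F, forall M, is_subgroup M} ->
  exists F', [/\ {subset F <= F'}, {in F', forall M, is_subgroup M} & inter_closed F'].
Proof.
(* Keeping [setT] in the family ensures that adjoining the intersections with [M] adjoins [M]
   itself. *)
move=> sF; suff [F' [FF' sF' cF' _]] : exists F' : seq (set G), [/\ {subset F <= F'},
    {in F', forall M, is_subgroup M}, inter_closed F' & setT \in F'] by exists F'.
elim: F sF => [_|M F IH sF].
  exists [:: setT]; split=> // [M|M N|].
  - by rewrite inE => /eqP->; apply: subgroupT.
  - by rewrite !mem_seq1 => /eqP-> /eqP->; rewrite setIT.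
  - by rewrite inE.
have [|F' [FF' sF' cF' TF']] := IH.
  by move=> N NF; apply: sF; rewrite inE NF orbT.
have sM : is_subgroup M by apply: sF; rewrite inE eqxx.
exists (F' ++ [seq M `&` N | N <- F']); split.
- move=> N; rewrite inE => /orP[/eqP->|/FF' NF']; rewrite mem_cat; last by rewrite NF'.
  by apply/orP; right; apply/mapP; exists setT; rewrite ?setIT.
- move=> N; rewrite mem_cat => /orP[/sF'//|/mapP[N' /sF' sN' ->]].
  exact: subgroupI.
- move=> N1 N2; rewrite !mem_cat.
  move=> /orP[N1F|/mapP[N1' N1F ->]] /orP[N2F|/mapP[N2' N2F ->]].
  + by rewrite cF'.
  + by apply/orP; right; rewrite setICA; apply/map_f/cF'.
  + by apply/orP; right; rewrite -setIA; apply/map_f/cF'.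
  + by apply/orP; right; rewrite setIACA setIid; apply/map_f/cF'.
- by rewrite mem_cat TF'.
Qed.

(** Binary operations concatenate the two families. A complement adds [setT] to the family, so that
    the relative ring contains the whole group. *)
Lemma coset_ring_comm_ring A : coset_ring G A -> exists F,
  [/\ {in F, forall M, is_subgroup M}, inter_closed F & comm_ring F A].
Proof.
move=> cA; suff [F sF FA] : exists2 F, {in F, forall M, is_subgroup M} & comm_ring F A.
  have [F' [FF' sF' cF']] := inter_closure F sF.
  by exists F'; split=> //; apply: comm_ring_mono FA.
have setr F : setring (comm_ring F) by apply: smallest_setring.
have HU A1 A2 : (exists2 F, {in F, forall M, is_subgroup M} & comm_ring F A1) ->
    (exists2 F, {in F, forall M, is_subgroup M} & comm_ring F A2) ->
    exists2 F, {in F, forall M, is_subgroup M} & comm_ring F A1 /\ comm_ring F A2.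
  move=> [F1 sF1 C1] [F2 sF2 C2]; exists (F1 ++ F2).
    by move=> M; rewrite mem_cat => /orP[/sF1|/sF2].
  by split; [apply: comm_ring_mono C1|apply: comm_ring_mono C2] => M MF;
    rewrite mem_cat MF ?orbT.
move: A cA; apply: smallest_sub.
  split.
  - by exists set0; exists [::] => //; case: (setr [::]).
  - move=> A1 A2 /HU /[apply] -[F sF [C1 C2]]; exists F => //.
    by case: (setr F) => _ + _; apply.
  - move=> A1 A2 /HU /[apply] -[F sF [C1 C2]]; exists F => //.
    exact: (setring_setI_closed (setr F)).
  - move=> A [F sF CA]; exists (setT :: F).
      by move=> M; rewrite inE => /orP[/eqP->|/sF //]; apply: subgroupT.
    rewrite -setTD; case: (setr (setT :: F)) => _ _; apply.
      apply: sub_gen_smallest; exists 1, setT; split=> //; first exact: subgroupT.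
      by exists setT; [rewrite inE eqxx|split; apply: sub_almost_sub].
    by apply: comm_ring_mono CA => M MF; rewrite inE MF orbT.
move=> _ [x _ [K sK <-]]; exists [:: K]; first by move=> M; rewrite inE => /eqP->.
apply: sub_gen_smallest; exists x, K; rewrite lcoset_image; split=> //.
by exists K; [rewrite inE|split; apply: sub_almost_sub].
Qed.

Lemma two_sided_ring_trans A0 s t A :
  two_sided_ring [set A0] A -> two_sided_ring [set A0] [set y | A (s * y * t)].
Proof.
set B := two_sided_ring _; have rB : setring B by apply: smallest_setring.
move: A; apply: (smallest_sub (X := [set A | B [set y | A (s * y * t)]])).
  have [B0 BU BD] := rB; split=> // [A V|A V]; first exact: BU.
  exact: BD.
move=> _ [s' [t' [_ -> ->]]]; apply: sub_gen_smallest.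
exists (s^-1 * s'), (t' * t^-1), A0 => //; apply/seteqP; split=> y /=.
  by move=> [z Az ez]; exists z => //; rewrite -[y](mulKg s) -[s * y](mulgK t) -ez; gsimp.
by move=> [z Az <-]; exists z => //; gsimp.
Qed.

Lemma two_sided_ring_splits A0 L A : coset_ring G A0 -> is_subgroup L ->
  two_sided_ring [set A0] A -> splits L A.
Proof.
move=> cA0 sL; move: A; apply: smallest_sub.
  split; first exact: splits0.
    by move=> A V; apply: splitsU.
  by move=> A V; apply: splitsD.
move=> _ [s [t [_ -> ->]]].
rewrite (_ : image _ _ = [set y | A0 (s^-1 * y * t^-1)]); first exact: coset_ring_splits.
apply/seteqP; split=> y /=; first by move=> [z Az <-]; gsimp.
by move=> Ay; exists (s^-1 * y * t^-1) => //; gsimp.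
Qed.

(** Each member of a generated ring is built from finitely many generators. *)
Lemma left_ring_finite (F : set (set G)) A : left_ring F A ->
  exists2 Hs : seq (set G), {in Hs, forall H, F H} & left_ring [set` Hs] A.
Proof.
have mono (Hs Hs' : seq (set G)) : {subset Hs <= Hs'} ->
    left_ring [set` Hs] `<=` left_ring [set` Hs'].
  by move=> HH; apply: sub_setring2 => _ [s _ [K KH <-]]; exists s => //; exists K => //; apply: HH.
have HU A1 A2 : (exists2 Hs : seq (set G), {in Hs, forall H, F H} & left_ring [set` Hs] A1) ->
    (exists2 Hs : seq (set G), {in Hs, forall H, F H} & left_ring [set` Hs] A2) ->
    exists2 Hs : seq (set G), {in Hs, forall H, F H} &
      left_ring [set` Hs] A1 /\ left_ring [set` Hs] A2.
  move=> [H1 sH1 C1] [H2 sH2 C2]; exists (H1 ++ H2).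
    by move=> M; rewrite mem_cat => /orP[/sH1|/sH2].
  by split; [apply: mono C1|apply: mono C2] => M MF; rewrite mem_cat MF ?orbT.
move: A; apply: smallest_sub.
  split; first by exists [::] => //; apply: setring0.
    by move=> A1 A2 /HU /[apply] -[Hs sHs [C1 C2]]; exists Hs => //; apply: setringU.
  by move=> A1 A2 /HU /[apply] -[Hs sHs [C1 C2]]; exists Hs => //; apply: setringD.
move=> _ [s _ [K FK <-]]; exists [:: K]; first by move=> M; rewrite inE => /eqP->.
by apply: sub_gen_smallest; exists s => //; exists K => //=; rewrite inE.
Qed.

End CosetRing.

Theorem theorem3p2 (G : groupType) (Y : set G) (hY : coset_ring G Y) :
  exists (n : nat) (H : 'I_n -> set G),
    [/\ forall i, is_subgroup (H i),
        forall i, two_sided_ring [set Y] (H i)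
      & left_ring (range H) Y].
Proof.
have [F [sF cF FY]] := coset_ring_comm_ring Y hY.
have rB : setring (two_sided_ring [set Y]) by apply: smallest_setring.
have BY : two_sided_ring [set Y] Y.
  apply: sub_gen_smallest; exists 1%g, 1%g, Y => //.
  apply/seteqP; split=> y; first by exists y; rewrite ?mul1g ?mulg1.
  by move=> [z Yz <-]; rewrite mul1g mulg1.
have TY : left_ring [set K | is_subgroup K /\ two_sided_ring [set Y] K] Y.
  apply: (sub_left_ring (two_sided_ring [set Y]) F) => //.
  - move=> g A /(two_sided_ring_trans Y g 1%g).
    by rewrite (_ : mkset _ = ltrans g A) //; apply/seteqP; split=> y /=; rewrite mulg1.
  - move=> g A /(two_sided_ring_trans Y 1%g g).
    by rewrite (_ : mkset _ = rtrans g A) //; apply/seteqP; split=> y /=; rewrite mul1g.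
  - by move=> L A sL; apply: two_sided_ring_splits.
have [Hs HsP HsY] := left_ring_finite _ _ TY.
(* The default [set0] is never reached, as every index is below [size Hs]. *)
exists (size Hs), (fun i => nth set0 Hs i); split=> [i|i|].
- by have [] := HsP _ (mem_nth set0 (ltn_ord i)).
- by have [] := HsP _ (mem_nth set0 (ltn_ord i)).
apply: sub_setring2 HsY => _ [s _ [K KH <-]]; exists s => //; exists K => //.
have lti : index K Hs < size Hs by rewrite index_mem.
by exists (Ordinal lti) => //=; rewrite nth_index.
Qed.
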